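(* Let $\mathbb{T}$ be a classical first-order theory with first-order spectrum $\mathcal{M}^{fo}=\mathcal{M}(\mathbb{T})^{fo}$, let $x:A$ be a context, and suppose that for every labelled model $\mu\in\mathcal{M}_0^{fo}$ a subset $S_\mu\subseteq |M_\mu|^x$ is given. Then the subsets $S_\mu$ are first-order definable (i.e. there is a first-order formula $\varphi(x)$ with $S_\mu=\varphi^{M_\mu}$ for all $\mu$) if and only if the union $\bigcup_\mu S_\mu=\{\langle \mu,a\rangle : a\in S_\mu\}$ is a compact equivariant subsheaf of $[\![A]\!]^{fo}$.
   Context: $\mathcal{L}$ is a multi-sorted first-order language with set of basic sorts $\mathcal{A}$; all formulas are written in a fixed finite context $x=\langle x_1:A_1,\dots,x_n:A_n\rangle$ (abbreviated $x:A$), and $|M|^x=A_1^M\times\dots\times A_n^M$. Fix a regular cardinal $\kappa\ge|\mathcal{L}|+\aleph_0$. First-order formulas are those of classical first-order logic, generated from atomic formulas by $\top,\wedge,\exists,\neg$. A labelled model $\mu$ (a point of $\mathcal{M}_0^{fo}$) is a $\mathbb{T}$-model $M_\mu$ together with, for each basic sort $A$, a subset $K^A_\mu\subseteq\kappa$ and a function $v^A_\mu:K^A_\mu\to A^{M_\mu}$ all of whose fibres are infinite. For a context $x=\langle x_i:A_i\rangle$ and $k\in\kappa^n$, $k$ is defined at $\mu$ if $k_i\in K_\mu^{A_i}$ for all $i$; then $\mu(k)=(v_\mu^{A_i}(k_i))_i\in|M_\mu|^x$. The topology on $\mathcal{M}^{fo}_0$ has as basis the sets $V_{\varphi(k)}=\{\mu:k\text{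 is defined at }\mu,\ M_\mu\models\varphi(\mu(k))\}$, with $\varphi(x)$ ranging over all first-order formulas. $\mathcal{M}_1^{fo}$ is the set of model isomorphisms $\alpha:M_\mu\cong M_\nu$ (not required to respect labellings), with topology generated by $\mathrm{dom}^{-1}(V_{\varphi(k)})$, $\mathrm{cod}^{-1}(V_{\varphi(k)})$ and $V_{k\mapsto l}=\{\alpha:\mu\to\nu\mid k,l\text{ defined at }\mu,\nu\text{ resp.},\ \alpha(\mu(k))=\nu(l)\}$. This is a topological groupoid $\mathcal{M}^{fo}$. An equivariant sheaf is an étale space $F\to\mathcal{M}^{fo}_0$ with a continuous action $\rho$, $\rho_\alpha:F_\mu\to F_\nu$ for $\alpha:\mu\to\nu$, respecting identities and composition; an equivariant subsheaf is an open subset stable under the action. It is compact if every cover of it by equivariant subsheaves has a finite subcover. $[\![A]\!]^{fo}$ is the set of pairs $\langle\mu,a\rangle$ with $\mu\in\mathcal{M}^{fo}_0$ and $a\in|M_\mu|^x$, with basic open sets $\{\langle\mu,a\rangle: l\text{ is defined at }\mu,\ M_\mu\models\varphi(a,\mu(l))\}$ for $\varphi(x,y)$ a first-order formula and $l$ a parameter sequence for $y$; it is an equivariant sheaf via $\rho_\alpha\langle\mu,a\rangle=\langle\nu,\alpha(a)\rangle$. *)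

(* Defs.v *)
From HB Require Import structures.
From mathcomp Require Import all_boot all_classical.
From mathcomp Require Import topology_structure product_topology subspace_topology.

Set Implicit Arguments.
Unset Strict Implicit.
Unset Printing Implicit Defensive.

Local Open Scope classical_set_scope.
Local Open Scope card_scope.

(* A cardinal is represented by a type having that cardinality.  It is regular
   when it is infinite and not the cardinality of a union of fewer than [K]
   sets of cardinality less than [K]. *)

Definition card_lt T U (A : set T) (B : set U) : Prop := A #<= B /\ ~ (B #<= A).

Definition regular_cardinal (K : Type) : Prop :=
  infinite_set [set: K] /\
  forall (I : Type) (F : I -> set K),
    card_lt [set: I] [set: K] -> (forall i, card_lt (F i) [set: K]) ->
    card_lt (\bigcup_i F i) [set: K].

Record language := Language {
  sorts : Type;
  fsym : Type;
  fdom : fsym -> seq sorts;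
  fcod : fsym -> sorts;
  rsym : Type;
  rdom : rsym -> seq sorts
}.

Definition symbols (L : language) : Type := (sorts L + (fsym L + rsym L))%type.

(* [prods X [:: A1; ...; An]] is [X A1 * (... * (X An * unit))]. *)
Fixpoint prods (S : Type) (X : S -> Type) (G : seq S) : Type :=
  if G is A :: G' then (X A * prods X G')%type else unit.

Fixpoint pcat (S : Type) (X : S -> Type) (G D : seq S) :
    prods X G -> prods X D -> prods X (G ++ D) :=
  match G return prods X G -> prods X D -> prods X (G ++ D) with
  | [::] => fun _ b => b
  | A :: G' => fun a b => (a.1, pcat a.2 b)
  end.

Fixpoint pmap_prods (S : Type) (X Y : S -> Type) (f : forall A, X A -> Y A)
    (G : seq S) : prods X G -> prods Y G :=
  match G return prods X G -> prods Y G with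
  | [::] => fun _ => tt
  | A :: G' => fun a => (f A a.1, pmap_prods f a.2)
  end.

(* A context is a list of sorts; [var G A] is the type of positions of [A] in
   [G] (well-sorted de Bruijn indices). *)
Inductive var (S : Type) : seq S -> S -> Type :=
| VZ A G : var (A :: G) A
| VS A B G : var G A -> var (B :: G) A.

Fixpoint plookup (S : Type) (X : S -> Type) (G : seq S) (A : S) (v : var G A) :
    prods X G -> X A :=
  match v in var G A return prods X G -> X A with
  | VZ _ _ => fun a => a.1
  | VS _ _ _ w => fun a => plookup w a.2
  end.

Inductive term (L : language) (G : seq (sorts L)) : sorts L -> Type :=
| Var A : var G A -> term G A
| App (f : fsym L) : args G (fdom f) -> term G (fcod f)
with args (L : language) (G : seq (sorts L)) : seq (sorts L) -> Type :=
| ANil : args G [::]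
| ACons A D : term G A -> args G D -> args G (A :: D).

(* [Ex] binds the first variable of the context of its body. *)
Inductive formula (L : language) : seq (sorts L) -> Type :=
| Rel G (r : rsym L) : args G (rdom r) -> formula G
| Eq G A : term G A -> term G A -> formula G
| Top G : formula G
| And G : formula G -> formula G -> formula G
| Not G : formula G -> formula G
| Ex G A : formula (A :: G) -> formula G.

Arguments Top {L G}.

Definition sentence (L : language) : Type := @formula L [::].

(* Sorts may be interpreted by empty types. *)
Record structure (L : language) := Structure {
  carrier :> sorts L -> Type;
  fint : forall f : fsym L, prods carrier (fdom f) -> carrier (fcod f);
  rint : forall r : rsym L, prods carrier (rdom r) -> Prop
}.

Fixpoint teval (L : language) (M : structure L) G A (t : term G A)
    (a : prods M G) : M A :=
  match t in term _ A return M A with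
  | Var _ v => plookup v a
  | App f ts => fint (aeval ts a)
  end
with aeval (L : language) (M : structure L) G D (ts : args G D)
    (a : prods M G) : prods M D :=
  match ts in args _ D return prods M D with
  | ANil => tt
  | ACons _ _ t ts' => (teval t a, aeval ts' a)
  end.

Fixpoint sat (L : language) (M : structure L) G (phi : formula G) :
    prods M G -> Prop :=
  match phi in formula G return prods M G -> Prop with
  | Rel _ r ts => fun a => rint (aeval ts a)
  | Eq _ _ t s => fun a => teval t a = teval s a
  | Top _ => fun _ => True
  | And _ p q => fun a => sat p a /\ sat q a
  | Not _ p => fun a => ~ sat p a
  | Ex _ A p => fun a => exists x : M A, @sat L M (A :: _) p (x, a)
  end.

Definition vlift (S : Type) (G D : seq S) (B : S)
    (r : forall A, var G A -> var D A) A (v : var (B :: G) A) : var (B :: D) A.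
Proof.
exact: (match v in var G' A return
    match G' with
    | [::] => unit
    | B :: G => (forall A, var G A -> var D A) -> var (B :: D) A
    end with
  | VZ A G => fun _ => VZ A D
  | VS _ B _ w => fun r => VS B (r _ w)
  end r).
Defined.

Fixpoint vlifts (S : Type) (E G D : seq S) (r : forall A, var G A -> var D A) :
    forall A, var (E ++ G) A -> var (E ++ D) A :=
  match E return forall A, var (E ++ G) A -> var (E ++ D) A with
  | [::] => r
  | B :: E' => vlift (vlifts (E := E') r)
  end.

Fixpoint vinl (S : Type) (G D : seq S) A (v : var G A) : var (G ++ D) A :=
  match v in var G A return var (G ++ D) A with
  | VZ A G => VZ A (G ++ D)
  | VS _ B _ w => VS B (vinl D w)
  end.

Fixpoint vinr (S : Type) (G D : seq S) A (v : var D A) : var (G ++ D) A :=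
  match G return var (G ++ D) A with
  | [::] => v
  | B :: G' => VS B (vinr G' v)
  end.

Fixpoint tren (L : language) (G D : seq (sorts L))
    (r : forall A, var G A -> var D A) A (t : term G A) : term D A :=
  match t in term _ A return term D A with
  | Var _ v => Var (r _ v)
  | App f ts => App (aren r ts)
  end
with aren (L : language) (G D : seq (sorts L))
    (r : forall A, var G A -> var D A) E (ts : args G E) : args D E :=
  match ts in args _ E return args D E with
  | ANil => ANil D
  | ACons _ _ t ts' => ACons (tren r t) (aren r ts')
  end.

Fixpoint fren (L : language) (G : seq (sorts L)) (phi : formula G) :
    forall D, (forall A, var G A -> var D A) -> formula D :=
  match phi in formula G
    return forall D, (forall A, var G A -> var D A) -> formula D with
  | Rel _ _ ts => fun _ r => Rel (aren r ts)
  | Eq _ _ t s => fun _ r => Eq (tren r t) (tren r s)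
  | Top _ => fun _ _ => Top
  | And _ p q => fun _ r => And (fren p r) (fren q r)
  | Not _ p => fun _ r => Not (fren p r)
  | Ex _ _ p => fun _ r => Ex (fren p (vlift r))
  end.

Scheme term_args_ind := Induction for term Sort Prop
with args_term_ind := Induction for args Sort Prop.

Section Renaming.
Context (S : Type) (X : S -> Type).

Definition agree (G D : seq S) (r : forall A, var G A -> var D A)
    (a : prods X D) (b : prods X G) : Prop :=
  forall A (v : var G A), plookup v b = plookup (r A v) a.

Lemma var_cons_ind (B : S) (G : seq S) (P : forall A, var (B :: G) A -> Prop) :
  P B (VZ B G) -> (forall A (v : var G A), P A (VS B v)) ->
  forall A (v : var (B :: G) A), P A v.
Proof.
move=> PZ PS A v.
exact: (match v as v0 in var G' A return
    match G' return var G' A -> Prop with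
    | [::] => fun _ => True
    | B :: G => fun v => forall P : forall A, var (B :: G) A -> Prop,
        P B (VZ B G) -> (forall A (v : var G A), P A (VS B v)) -> P A v
    end v0 with
  | VZ A G => fun _ PZ _ => PZ
  | VS _ _ _ w => fun _ _ PS => PS _ w
  end P PZ PS).
Qed.

Lemma var_nil (A : S) (v : var [::] A) : False.
Proof.
exact: (match v in var G A return (if G is [::] then False else True) with
        | VZ _ _ => I | VS _ _ _ _ => I end).
Qed.

Lemma agree_lift (G D : seq S) B (r : forall A, var G A -> var D A)
    (a : prods X D) (b : prods X G) (x : X B) :
  agree r a b -> @agree (B :: G) (B :: D) (vlift r) (x, a) (x, b).
Proof. by move=> ab A; elim/var_cons_ind. Qed.

Lemma agree_lifts (E G D : seq S) (r : forall A, var G A -> var D A)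
    (c : prods X E) (a : prods X D) (b : prods X G) :
  agree r a b -> agree (vlifts (E := E) r) (pcat c a) (pcat c b).
Proof.
move=> ab; elim: E c => [|B E IH] //= c.
exact: (agree_lift c.1 (IH c.2)).
Qed.

Lemma agree_inl (G D : seq S) (a : prods X G) (b : prods X D) :
  agree (fun A => @vinl S G D A) (pcat a b) a.
Proof. by move=> A v; elim: v a => //= ? ? ? ? IH a; exact: IH. Qed.

Lemma agree_inr (G D : seq S) (a : prods X G) (b : prods X D) :
  agree (fun A => @vinr S G D A) (pcat a b) b.
Proof. by move=> A v; elim: G a => //= B G IH a; exact: IH. Qed.

Lemma plookup_inj (G : seq S) (a b : prods X G) :
  (forall A (v : var G A), plookup v a = plookup v b) -> a = b.
Proof.
elim: G a b => [[] []|A G IH [a a'] [b b'] ab] //.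
rewrite (IH a' b'); last by move=> B v; exact: (ab _ (VS A v)).
by have /= -> := ab _ (VZ A G).
Qed.

End Renaming.

Lemma teval_ren (L : language) (M : structure L) (G D : seq (sorts L))
    (r : forall A, var G A -> var D A) (a : prods M D) (b : prods M G) :
  agree r a b -> forall A (t : term G A), teval (tren r t) a = teval t b.
Proof.
move=> ab; apply: (@term_args_ind L G (fun A t => teval (tren r t) a = teval t b)
  (fun E ts => aeval (aren r ts) a = aeval ts b)) => //=.
- by move=> f ts ->.
- by move=> A E t -> ts ->.
Qed.

Lemma aeval_ren (L : language) (M : structure L) (G D : seq (sorts L))
    (r : forall A, var G A -> var D A) (a : prods M D) (b : prods M G) :
  agree r a b -> forall E (ts : args G E), aeval (aren r ts) a = aeval ts b.
Proof.
move=> ab E; elim => //= A D' t ts ->; by rewrite (teval_ren ab).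
Qed.

Lemma sat_ren (L : language) (M : structure L) (G : seq (sorts L))
    (phi : formula G) (D : seq (sorts L)) (r : forall A, var G A -> var D A)
    (a : prods M D) (b : prods M G) :
  agree r a b -> sat (fren phi r) a <-> sat phi b.
Proof.
elim: phi D r a b => /= {G}.
- by move=> G s ts D r a b ab; rewrite (aeval_ren ab).
- by move=> G A t s D r a b ab; rewrite !(teval_ren ab).
- by [].
- by move=> G p IHp q IHq D r a b ab; rewrite (IHp _ _ _ _ ab) (IHq _ _ _ _ ab).
- by move=> G p IHp D r a b ab; rewrite (IHp _ _ _ _ ab).
- move=> G A p IHp D r a b ab.
  by split=> -[x px]; exists x; apply/(IHp _ _ _ _ (agree_lift x ab)).
Qed.

Fixpoint eqs (L : language) (G D : seq (sorts L)) :
    (forall A, var G A -> var D A) -> (forall A, var G A -> var D A) ->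
    formula D :=
  match G return (forall A, var G A -> var D A) ->
    (forall A, var G A -> var D A) -> formula D with
  | [::] => fun _ _ => Top
  | A :: G' => fun u w => And (Eq (Var (u _ (VZ A G'))) (Var (w _ (VZ A G'))))
      (eqs (fun B v => u _ (VS A v)) (fun B v => w _ (VS A v)))
  end.

Lemma sat_eqs (L : language) (M : structure L) (G D : seq (sorts L))
    (u w : forall A, var G A -> var D A) (a : prods M D) (b c : prods M G) :
  agree u a b -> agree w a c -> sat (eqs u w) a <-> b = c.
Proof.
elim: G u w b c => [|A G IH] u w b c ub wc /=.
  by case: b c {ub wc} => -[].
case: b c ub wc => [b b'] [c c'] ub wc.
rewrite (IH _ _ b' c'); last 2 first.
- by move=> B v; exact: (ub _ (VS A v)).
- by move=> B v; exact: (wc _ (VS A v)).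
rewrite -(ub _ (VZ A G)) -(wc _ (VZ A G)) /=.
by split=> [[-> ->]|[-> ->]].
Qed.

Record iso (L : language) (M N : structure L) := Iso {
  imap :> forall A, M A -> N A;
  imap_bij : forall A, bijective (@imap A);
  imap_fint : forall (f : fsym L) (a : prods M (fdom f)),
    imap (fint a) = fint (pmap_prods imap a);
  imap_rint : forall (r : rsym L) (a : prods M (rdom r)),
    rint a <-> rint (pmap_prods imap a)
}.

Lemma pmap_prods_id (S : Type) (X : S -> Type) (G : seq S) (a : prods X G) :
  pmap_prods (fun _ x => x) a = a.
Proof. by elim: G a => [[]|A G IH [a b]] //=; rewrite IH. Qed.

Lemma pmap_prods_comp (S : Type) (X Y Z : S -> Type) (f : forall A, X A -> Y A)
    (g : forall A, Y A -> Z A) (G : seq S) (a : prods X G) :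
  pmap_prods (fun A x => g A (f A x)) a = pmap_prods g (pmap_prods f a).
Proof. by elim: G a => [[]|A G IH [a b]] //=; rewrite IH. Qed.

Definition iso_id (L : language) (M : structure L) : iso M M.
Proof.
exists (fun _ x => x).
- by move=> A; exists id.
- by move=> f a; rewrite pmap_prods_id.
- by move=> r a; rewrite pmap_prods_id.
Defined.

Definition iso_comp (L : language) (M N P : structure L) (g : iso N P)
    (f : iso M N) : iso M P.
Proof.
exists (fun A x => g A (f A x)).
- move=> A; exact: bij_comp (imap_bij g A) (imap_bij f A).
- by move=> s a; rewrite imap_fint imap_fint -pmap_prods_comp.
- by move=> r a; rewrite (imap_rint f) (imap_rint g) -pmap_prods_comp.
Defined.

(* The partial function [v : K -> M A], with [K] a subset of [kappa], is
   encoded as [lab A : kappa -> option (M A)], [K] being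
   [[set k | lab A k <> None]].  All fibres over [M A] being infinite, [lab A]
   reaches every element. *)
Record lmodel (L : language) (T : set (sentence L)) (kappa : Type) := LModel {
  model :> structure L;
  modelP : forall phi, T phi -> @sat L model [::] phi tt;
  lab : forall A, kappa -> option (model A);
  lab_fibre : forall A (a : model A), infinite_set [set k | lab A k = Some a]
}.

Definition labels (L : language) (kappa : Type) (G : seq (sorts L)) : Type :=
  prods (fun _ : sorts L => kappa) G.

(* [mu(k)]: [Some] exactly when [k] is defined at [mu]. *)
Fixpoint assign (L : language) (T : set (sentence L)) (kappa : Type)
    (mu : lmodel T kappa) (G : seq (sorts L)) :
    labels kappa G -> option (prods mu G) :=
  match G return labels kappa G -> option (prods mu G) with
  | [::] => fun _ => Some tt
  | A :: G' => fun k =>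
      match lab mu A k.1, assign mu k.2 with
      | Some a, Some b => Some (a, b)
      | _, _ => None
      end
  end.

Section Spectrum.
Context (L : language) (T : set (sentence L)) (kappa : Type).
Local Notation lmodel := (lmodel T kappa).
Local Notation labels := (@labels L kappa).

Lemma assign_cat (mu : lmodel) G D (k : labels G) (l : labels D) a b :
  assign mu k = Some a -> assign mu l = Some b ->
  assign mu (pcat k l : labels (G ++ D)) = Some (pcat a b).
Proof.
move=> + lb; elim: G k a => [k []|A G IH [k k'] [a a']] //=.
case: (lab mu A k) => // x; case E: (assign mu k') => [c|//] [-> <-].
by rewrite (IH _ _ E).
Qed.

Lemma assign_catI (mu : lmodel) G D (k : labels G) (l : labels D) c :
  assign mu (pcat k l : labels (G ++ D)) = Some c ->
  exists a b, [/\ assign mu k = Some a, assign mu l = Some b & c = pcat a b].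
Proof.
elim: G k c => [k c lc|A G IH [k k'] c /=]; first by exists tt, c.
case: (lab mu A k) => // x; case E: (assign mu _) => [d|//] [<-].
by have [a [b [-> -> ->]]] := IH _ _ E; exists (x, a), b.
Qed.

Lemma assign_surj (mu : lmodel) G (a : prods mu G) :
  exists k : labels G, assign mu k = Some a.
Proof.
elim: G a => [[]|A G IH [a b]]; first by exists tt.
have [k lk] := IH b.
have [j /= lj] := infinite_setN0 (@lab_fibre _ _ _ mu A a).
by exists (j, k); rewrite /= lj lk.
Qed.

Definition Vobj G (phi : formula G) (k : labels G) : set lmodel :=
  [set mu | exists2 a, assign mu k = Some a & sat phi a].

Definition Vobjs : set (set lmodel) :=
  [set V | exists G (phi : formula G) (k : labels G), V = Vobj phi k].

Lemma Vobjs_cover : \bigcup_(V in Vobjs) V = setT.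
Proof.
apply/seteqP; split=> // mu _.
exists (@Vobj [::] Top tt); first by exists [::], Top, tt.
by exists tt.
Qed.

Lemma Vobjs_join (U V : set lmodel) mu : Vobjs U -> Vobjs V -> U mu -> V mu ->
  exists W, [/\ Vobjs W, W mu & W `<=` U `&` V].
Proof.
move=> [G [phi [k ->]]] [D [psi [l ->]]] [a ka pa] [b lb pb].
exists (@Vobj (G ++ D) (And (fren phi (fun A => @vinl _ G D A))
  (fren psi (fun A => @vinr _ G D A))) (pcat k l)); split.
- by do 3 eexists.
- exists (pcat a b); first exact: assign_cat.
  by split; [apply/(sat_ren phi (agree_inl a b))|
    apply/(sat_ren psi (agree_inr a b))].
- move=> nu [c /assign_catI[a' [b' [ka' lb' ->]]]] /=.
  rewrite (sat_ren phi (agree_inl a' b')) (sat_ren psi (agree_inr a' b')).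
  by move=> [? ?]; split; [exists a'|exists b'].
Qed.

HB.instance Definition _ := gen_eqMixin lmodel.
HB.instance Definition _ := gen_choiceMixin lmodel.
HB.instance Definition _ :=
  @isBaseTopological.Build lmodel (set lmodel) Vobjs id Vobjs_cover Vobjs_join.

Lemma openVobj G (phi : formula G) (k : labels G) : open (Vobj phi k).
Proof.
exists [set Vobj phi k]; last by rewrite bigcup_set1.
by move=> _ ->; do 3 eexists.
Qed.

(* Arrows are isomorphisms of the underlying models only. *)
Record arrow := Arrow {
  adom : lmodel;
  acod : lmodel;
  aiso : iso adom acod
}.

Definition Varr G (k l : labels G) : set arrow :=
  [set f | exists a b, [/\ assign (adom f) k = Some a,
    assign (acod f) l = Some b & pmap_prods (aiso f) a = b]].

Definition Varrs : set (set arrow) :=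
  [set adom @^-1` V | V in Vobjs] `|` [set acod @^-1` V | V in Vobjs] `|`
  [set V | exists G (k l : labels G), V = Varr k l].

HB.instance Definition _ := gen_eqMixin arrow.
HB.instance Definition _ := gen_choiceMixin arrow.
HB.instance Definition _ :=
  @isSubBaseTopological.Build arrow (set arrow) Varrs id.

Lemma openVarrs (V : set arrow) : Varrs V -> open V.
Proof.
move=> VV; exists [set V]; last by rewrite bigcup_set1.
by move=> _ ->; exact: (@finI_from1 _ _ Varrs id).
Qed.

(* For [p] continuous, injective and open on the open set [U], the restriction
   of [p] is a homeomorphism from [U] to the open set [p @` U]. *)
Definition local_homeomorphism (X Y : topologicalType) (p : X -> Y) : Prop :=
  forall x, exists U : set X,
    [/\ open U, U x, {within U, continuous p}, set_inj U p &
      forall V, open V -> V `<=` U -> open (p @` V)].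

(* [esact f e he] is [rho_f e], for [e] in the fibre over [adom f].  The action
   map is defined on pairs [(f, e)] with [esproj e = adom f], topologised as a
   subspace of the product. *)
Record eqsheaf := EqSheaf {
  esp :> topologicalType;
  esproj : esp -> lmodel;
  esproj_etale : local_homeomorphism esproj;
  esact : forall (f : arrow) (e : esp), esproj e = adom f -> esp;
  esproj_act : forall f e (he : esproj e = adom f),
    esproj (esact he) = acod f;
  esact_id : forall (mu : lmodel) e
    (he : esproj e = adom (@Arrow mu mu (iso_id mu))),
    esact he = e;
  esact_comp : forall (mu nu xi : lmodel) (g : iso nu xi) (f : iso mu nu) e
    (he : esproj e = adom (@Arrow mu nu f))
    (he' : esproj e = adom (@Arrow mu xi (iso_comp g f)))
    (hfe : esproj (esact he) = adom (@Arrow nu xi g)),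
    esact he' = esact hfe;
  esact_continuous : forall f e (he : esproj e = adom f) (W : set esp),
    nbhs (esact he) W ->
    \forall f' \near f & e' \near e,
      forall he' : esproj e' = adom f', W (esact he')
}.

Definition eqsubsheaf (F : eqsheaf) (E : set F) : Prop :=
  open E /\ forall f e (he : esproj e = adom f), E e -> E (esact he).

(* The equivariant subsheaves of an equivariant subsheaf [E] of [F] are those
   of [F] that are included in [E], since [E] is open. *)
Definition compact_eqsubsheaf (F : eqsheaf) (E : set F) : Prop :=
  eqsubsheaf E /\
  forall C : set (set F),
    (forall U, C U -> eqsubsheaf U /\ U `<=` E) -> \bigcup_(U in C) U = E ->
    exists C', [/\ C' `<=` C, finite_set C' & \bigcup_(U in C') U = E].

Section DefinableSheaf.
Context (G : seq (sorts L)).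

Record dpoint := DPoint { dbase : lmodel; dval : prods dbase G }.

Definition Vdef D (phi : formula (G ++ D)) (l : labels D) : set dpoint :=
  [set e | exists2 b, assign (dbase e) l = Some b & sat phi (pcat (dval e) b)].

Definition Vdefs : set (set dpoint) :=
  [set V | exists D (phi : formula (G ++ D)) (l : labels D), V = Vdef phi l].

Lemma Vdefs_cover : \bigcup_(V in Vdefs) V = setT.
Proof.
apply/seteqP; split=> // e _.
exists (@Vdef [::] Top tt); first by exists [::], Top, tt.
by exists tt.
Qed.

Lemma Vdefs_join (U V : set dpoint) e : Vdefs U -> Vdefs V -> U e -> V e ->
  exists W, [/\ Vdefs W, W e & W `<=` U `&` V].
Proof.
move=> [D [phi [k ->]]] [D' [psi [l ->]]] [a ka pa] [b lb pb].
pose il := vlifts (E := G) (fun A => @vinl _ D D' A).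
pose ir := vlifts (E := G) (fun A => @vinr _ D D' A).
have alP mu (c : prods mu G) x y : agree il (pcat c (pcat x y)) (pcat c x).
  exact/agree_lifts/agree_inl.
have arP mu (c : prods mu G) x y : agree ir (pcat c (pcat x y)) (pcat c y).
  exact/agree_lifts/agree_inr.
exists (@Vdef (D ++ D') (And (fren phi il) (fren psi ir)) (pcat k l)); split.
- by do 3 eexists.
- exists (pcat a b); first exact: assign_cat.
  by split; [apply/(sat_ren phi (alP _ _ _ _))|apply/(sat_ren psi (arP _ _ _ _))].
- move=> e' [c /assign_catI[a' [b' [ka' lb' ->]]]] /=.
  rewrite (sat_ren phi (alP _ _ _ _)) (sat_ren psi (arP _ _ _ _)).
  by move=> [? ?]; split; [exists a'|exists b'].
Qed.

HB.instance Definition _ := gen_eqMixin dpoint.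
HB.instance Definition _ := gen_choiceMixin dpoint.
HB.instance Definition _ :=
  @isBaseTopological.Build dpoint (set dpoint) Vdefs id Vdefs_cover Vdefs_join.

Lemma openVdef D (phi : formula (G ++ D)) (l : labels D) : open (Vdef phi l).
Proof.
exists [set Vdef phi l]; last by rewrite bigcup_set1.
by move=> _ ->; do 3 eexists.
Qed.

Lemma open_dpoint (V : set dpoint) e : open V -> V e ->
  exists D (phi : formula (G ++ D)) (l : labels D),
    Vdef phi l e /\ Vdef phi l `<=` V.
Proof.
move=> [C CV <-] [B CB Be]; have [D [phi [l Bphi]]] := CV _ CB.
exists D, phi, l; rewrite -Bphi; split=> // x Bx.
by exists B.
Qed.

(* The points [<mu, mu(k)>]. *)
Definition Vsec (k : labels G) : set dpoint :=
  Vdef (eqs (fun A => @vinl _ G G A) (fun A => @vinr _ G G A)) k.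

Lemma VsecE k e : Vsec k e <-> assign (dbase e) k = Some (dval e).
Proof.
split=> [[b kb]|ke].
  by rewrite (sat_eqs (agree_inl _ _) (agree_inr _ _)) => ->.
by exists (dval e) => //; rewrite (sat_eqs (agree_inl _ _) (agree_inr _ _)).
Qed.

Lemma dbase_continuous : continuous dbase.
Proof.
apply/continuousP => V [C CV <-]; rewrite preimage_bigcup.
apply: bigcup_open => B /CV[D [phi [l ->]]].
suff -> : dbase @^-1` Vobj phi l = Vdef (fren phi (fun A => @vinr _ G D A)) l.
  exact: openVdef.
by apply/seteqP; split=> e [b lb pb]; exists b => //; move: pb;
  rewrite (sat_ren phi (agree_inr _ _)).
Qed.

Lemma dbase_open (V : set dpoint) : open V -> open (dbase @` V).
Proof.
move=> oV; rewrite openE => _ [[mu a] Ve <-].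
have [D [phi [l [[b lb pb] sV]]]] := open_dpoint oV Ve.
have [k ka] := assign_surj a.
rewrite /interior nbhsE; exists (@Vobj (G ++ D) phi (pcat k l)).
  split; first exact: openVobj.
  by exists (pcat a b) => //; exact: assign_cat.
move=> nu [c /assign_catI[a' [b' [ka' lb' ->]]] pc].
by exists (DPoint a') => //; apply: sV; exists b'.
Qed.

Lemma dbase_etale : local_homeomorphism dbase.
Proof.
move=> [mu a]; have [k ka] := assign_surj a.
exists (Vsec k); split.
- exact: openVdef.
- exact/VsecE.
- exact/continuous_subspaceT/dbase_continuous.
- move=> [nu b] [nu' b'] /set_mem/VsecE/= kb /set_mem/VsecE/= kb' e.
  by case: _ / e b' kb' => b'; rewrite kb => -[->].
- by move=> V oV _; exact: dbase_open.
Qed.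

(* [<mu, a> |-> <nu, f a>], for [f : mu -> nu]. *)
Definition dact (f : arrow) (e : dpoint) (he : dbase e = adom f) : dpoint :=
  DPoint (pmap_prods (aiso f) (eq_rect _ (fun mu : lmodel => prods mu G)
    (dval e) _ he)).

Lemma dactE (mu nu : lmodel) (f : iso mu nu) (a : prods mu G)
    (he : mu = mu) :
  @dact (Arrow f) (DPoint a) he = DPoint (pmap_prods f a).
Proof. by rewrite (Prop_irrelevance he erefl). Qed.

Lemma dbase_act f e (he : dbase e = adom f) : dbase (dact he) = acod f.
Proof. by []. Qed.

Lemma dact_id (mu : lmodel) e (he : dbase e = adom (@Arrow mu mu (iso_id mu))) : dact he = e.
Proof.
case: e he => nu a /= he; move: (he); case: _ / he => he.
by rewrite dactE pmap_prods_id.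
Qed.

Lemma dact_comp (mu nu xi : lmodel) (g : iso nu xi) (f : iso mu nu) e
    (he : dbase e = adom (@Arrow mu nu f)) (he' : dbase e = adom (@Arrow mu xi (iso_comp g f)))
    (hfe : dbase (dact he) = adom (@Arrow nu xi g)) :
  dact he' = dact hfe.
Proof.
case: e he he' hfe => mu' a /= he.
move: (he) f; case: _ / he => he f he'.
move=> hfe; rewrite (Prop_irrelevance he erefl) (Prop_irrelevance he' erefl).
by rewrite (Prop_irrelevance hfe erefl) /dact /= pmap_prods_comp.
Qed.

Lemma dact_continuous f e (he : dbase e = adom f) (W : set dpoint) :
  nbhs (dact he) W ->
  \forall f' \near f & e' \near e,
    forall he' : dbase e' = adom f', W (dact he').
Proof.
case: e f he => mu a [mu' nu f] /= he.
move: (he) f; case: _ / he => he f; rewrite dactE nbhsE => -[V [oV Ve] sVW].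
have [D [phi [l [[b /= lb pb] sV]]]] := open_dpoint oV Ve.
have [k ka] := assign_surj a; have [k' kfa] := assign_surj (pmap_prods f a).
exists (Varr k k' `&` acod @^-1` Vobj phi (pcat k' l : labels (G ++ D)),
  Vsec k); first split => /=.
- rewrite nbhsE; exists (Varr k k' `&`
    acod @^-1` Vobj phi (pcat k' l : labels (G ++ D))) => //; split.
    by apply: openI; apply: openVarrs;
      [right; do 3 eexists|left; right; eexists => //; do 3 eexists].
  split; first by exists a, (pmap_prods f a).
  by exists (pcat (pmap_prods f a) b); first exact: (assign_cat kfa lb).
- by rewrite nbhsE; exists (Vsec k) => //; split; [exact: openVdef|exact/VsecE].
move=> [[m n g] [m' c]] /= [[[x [y [/= kx ky xy]]] [z]]].
move=> /assign_catI[y' [b' [/=]]].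
rewrite ky => -[<-] lb' -> pz /VsecE/= kc he'.
move: (he') g x y kx ky xy pz; case: _ / he' => he' g x y kx ky xy pz.
rewrite dactE; apply/sVW/sV; exists b' => //=.
by move: kx; rewrite kc => -[->]; rewrite xy.
Qed.


Definition dsheaf : eqsheaf :=
  EqSheaf dbase_etale dbase_act dact_id dact_comp dact_continuous.

End DefinableSheaf.
End Spectrum.

(* Main.v *)
(* An open set that is stable under the isomorphisms is a union of sets defined
   by formulas without parameters: the parameters of a basic open set around a
   point can be quantified away, since a model may be relabelled at will.
   Compactness of an equivariant subsheaf therefore amounts to being a finite
   union of such sets.

   That a definable set is compact is the compactness theorem for models
   carrying a labelling, i.e. models of size at most kappa: such a model is
   obtained from finitely satisfiable data as the hull, under Skolem functions
   chosen in the factors, of the named point in an ultraproduct.  That the hull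
   is small rests on kappa * kappa = kappa, which follows from regularity. *)

Require Import Defs.
From mathcomp Require Import all_boot all_classical.
From mathcomp Require Import wochoice topology_structure.

Set Implicit Arguments.
Unset Strict Implicit.
Unset Printing Implicit Defensive.

Local Open Scope classical_set_scope.
Local Open Scope card_scope.

(** * Cardinal arithmetic *)

(** The inhabitant [k0] allows the injection to be a total function on [T], with arbitrary values
    outside [A]. *)
Lemma card_leTPex (T K : Type) (k0 : K) (A : set T) :
  A #<= [set: K] <-> exists f : T -> K, {in A &, injective f}.
Proof.
split.
  move: k0; elim/Ppointed: K => K; first by move/no.
  by move=> _ /pcard_injP.
case=> f inj_f; apply: card_le_trans (card_leT (f @` A)).
by have := inj_card_eq inj_f; rewrite card_eq_sym => /card_eqPle[].
Qed.

Lemma card_leT_ex (T K : Type) (k0 : K) (A : set K) :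
  [set: T] #<= A -> exists2 f : T -> K, (forall x, A (f x)) & injective f.
Proof.
move: k0; elim/Ppointed: K => K in A *; first by move/no.
move=> _ /pcard_leP[f]; exists f => [x|x y fxy]; first exact: funS.
by apply: (@inj _ _ _ f); rewrite ?inE.
Qed.

Lemma card_lt_le_trans (X Y Z : Type) (A : set X) (B : set Y) (C : set Z) :
  A #<= B -> card_lt B C -> card_lt A C.
Proof.
move=> AB [BC nCB]; split; first exact: card_le_trans BC.
by move=> CA; apply: nCB; exact: card_le_trans AB.
Qed.

Lemma finite_card_lt (X K : Type) (A : set X) :
  infinite_set [set: K] -> finite_set A -> card_lt A [set: K].
Proof.
move=> infK finA; have AK : A #<= [set: K].
  have [n An] := finA; move/infiniteP: infK; apply: card_le_trans.
  apply: card_le_trans (card_leT `I_n); by move/card_eqPle: An => [].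
by split=> // KA; apply: infK; exact: card_le_finite KA finA.
Qed.

Lemma well_order_exists (X : Type) : exists le : rel X,
  [/\ total le, antisymmetric le, transitive le &
    forall A : set X, A !=set0 -> exists2 z, A z & forall y, A y -> le z y].
Proof.
have [R wo] := well_ordering_principle {classic X}.
have minR (A : set X) : A !=set0 -> exists2 z, A z & forall y, A y -> R z y.
  move=> [x Ax]; have [|z [[Az mz] _]] := wo [pred x : X | `[<A x>]].
    by exists x; apply/asboolP.
  by exists z; [exact/asboolP|move=> y Ay; apply: mz; apply/asboolP].
have wo' : wo_chain R [pred _ : {classic X} | true] by move=> A _; exact: wo.
have totR : total R by move=> x y; apply: (wo_chainW wo').
have antiR : antisymmetric R.
  by move=> x y; apply: (wo_chain_antisymmetric wo').
exists R; split => // y x z xy yz.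
(* Transitivity comes from the least element of the three: if it is [y] or [z], antisymmetry
   identifies it with the element before it. *)
have [|t [->|[->|->]]] := minR [set t | t = x \/ (t = y \/ t = z)].
- by exists x; left.
- by move=> /(_ z); apply; right; right.
- by move=> /(_ x) yx; rewrite -(antiR y x) // xy yx //; left.
- by move=> /(_ y) zy; rewrite (antiR z y) // zy ?yz //; right; left.
Qed.

Lemma wf_of_minimal (X : Type) (R : X -> X -> Prop) :
  (forall A : set X, A !=set0 -> exists2 z, A z & forall y, A y -> ~ R y z) ->
  well_founded R.
Proof.
move=> minR x; apply: contrapT => nx.
have [|z nz mz] := minR [set x | ~ Acc R x]; first by exists x.
by apply: nz; constructor => y yz; apply: contrapT => ny; exact: mz yz.
Qed.

(** Well-founded recursion: [f x] is chosen among the values not yet taken at predecessors of [x] in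
    [D], and any two distinct points are comparable. The default [k0] is used only where no value is
    free, hence only outside [D]. *)
Lemma greedy_injection (X K : Type) (k0 : K) (R : X -> X -> Prop) (D : set X) :
  well_founded R -> (forall x y, x <> y -> R x y \/ R y x) ->
  (forall x, D x -> forall f : X -> K,
    exists k, forall y, D y -> R y x -> f y <> k) ->
  exists f : X -> K, {in D &, injective f}.
Proof.
move=> wfR totR fresh.
pose avoids x (f : forall y, R y x -> K) k :=
  forall y (yx : R y x), D y -> f y yx <> k.
pose F x (f : forall y, R y x -> K) : K :=
  if pselect (exists k, avoids x f k) is left e then projT1 (cid e) else k0.
pose f := Fix wfR (fun=> K) F.
have fE x : f x = F x (fun y _ => f y).
  rewrite /f Fix_eq // => z g h gh; congr F.
  by apply/functional_extensionality_dep => y; apply/funext => yz.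
have f_lt x y : D x -> D y -> R y x -> f y <> f x.
  move=> Dx Dy yx; rewrite (fE x) /F.
  case: pselect => [e|[]]; first by case: (cid e) => k /= /(_ _ yx Dy).
  by have [k kP] := fresh x Dx f; exists k => z zx Dz; exact: kP.
exists f => x y /set_mem Dx /set_mem Dy fxy; apply: contrapT => /totR[xy|yx].
- exact: (f_lt _ _ Dy Dx xy).
- exact: (f_lt _ _ Dx Dy yx).
Qed.

(** A well-order in the style of Goedel on pairs is fed to [greedy_injection]; regularity keeps the
    values used before any stage fewer than [K]. *)
Lemma regular_square (K : Type) :
  regular_cardinal K -> [set: (K * K)%type] #<= [set: K].
Proof.
move=> [infK regK].
have [k0 _] := infinite_setN0 infK.
have [le [tot anti trans minle]] := well_order_exists K.
have [leP [totP antiP _ minleP]] := well_order_exists (K * K)%type.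
pose seg (m : K) := [set x | le x m].
(* The order [le] need not have minimal order type, so an initial segment may be as large as [K].
   The injection is built on pairs from [W], where this does not happen. *)
pose W : set K := [set m | card_lt (seg m) [set: K]].
pose mx (p : K * K) := if le p.1 p.2 then p.2 else p.1.
have mx1 p : le p.1 (mx p).
  by rewrite /mx; case: ifP => //; have := tot p.1 p.1; rewrite orbb.
have mx2 p : le p.2 (mx p).
  rewrite /mx; case: ifPn => [_|]; first by have := tot p.2 p.2; rewrite orbb.
  by move=> /negP np; have := tot p.1 p.2 => /orP[/np|].
(* Pairs are compared by their maximum first, with [leP] breaking ties. *)
pose R (q p : K * K) := ~~ le (mx p) (mx q) \/ (mx q = mx p /\ ~~ leP p q).
have R_le q p : R q p -> le (mx q) (mx p).
  move=> [/negP n|[-> _]]; first by have := tot (mx q) (mx p) => /orP[|/n].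
  by have := tot (mx p) (mx p); rewrite orbb.
have wfR : well_founded R.
  apply: wf_of_minimal => A [p Ap].
  have [|m [p' Ap' p'm] mm] := minle (mx @` A); first by exists (mx p), p.
  have [|z [Az zm] mz] := minleP [set p | A p /\ mx p = m]; first by exists p'.
  exists z => // y Ay [|[yz]]; apply/negP; rewrite negbK.
    by rewrite zm; apply: mm; exists y.
  by apply: mz; rewrite -zm.
have totR x y : x <> y -> R x y \/ R y x.
  move=> xy; have [yx|] := boolP (le (mx y) (mx x)); last by left; left.
  have [xy'|] := boolP (le (mx x) (mx y)); last by right; left.
  have e : mx x = mx y by apply: anti; rewrite xy' yx.
  have [yxP|n] := boolP (leP y x); last by left; right.
  have [xyP|n] := boolP (leP x y); last by right; right.
  by exfalso; apply: xy; apply: antiP; rewrite xyP yxP.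
have [|g inj_g] := greedy_injection k0 (D := W `*` W) wfR totR.
  move=> p [Wp1 Wp2] f; set m := mx p.
  have Wm : card_lt (seg m) [set: K] by rewrite /m /mx; case: ifP.
  (* Every pair below [p] has both coordinates in [seg m], so the values of [f] there lie in the
     union of the sets [F z]: fewer than [K] sets, each smaller than [K]. By regularity some value
     is free. *)
  pose F (z : seg m) : set K := [set f (val z, b) | b in seg m].
  have [||_ ltF] := regK (seg m) F.
  - apply: card_lt_le_trans Wm.
    by have /card_eqPle[] := card_setT (seg m).
  - move=> z; apply: card_lt_le_trans Wm; exact: card_image_le.
  apply: contrapT => nk; apply: ltF; apply: subset_card_le => k _.
  apply: contrapT => nFk; apply: nk; exists k => -[a b] Dab Rab fk.
  have am : seg m a by exact: trans (mx1 (a, b)) (R_le _ _ Rab).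
  have bm : le b m by exact: trans (mx2 (a, b)) (R_le _ _ Rab).
  by apply: nFk; exists (SigSub (mem_set am)) => //; exists b.
(* If [W] is not everything, take the least [x] outside it: the strict segment below [x] lies in
   [W], and it has full size because adding the single point [x] to a smaller set would keep it
   small. *)
have KW : [set: K] #<= W.
  have [allW|] := pselect (forall x, W x).
    by apply: subset_card_le => x _; exact: allW.
  move=> /existsNP[x0 nx0].
  have [|x nx mx0] := minle (~` W); first by exists x0.
  have sx : ~ card_lt [set y | ~~ le x y] [set: K].
    move=> lt; apply: nx.
    have [] := regK bool (fun b => if b then [set y | ~~ le x y] else [set x]).
    - exact: finite_card_lt finite_finset.
    - by case=> //; exact: finite_card_lt (finite_set1 _).
    move=> le1 lt1; apply: card_lt_le_trans (conj le1 lt1).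
    apply: subset_card_le => y yx.
    have [xy|xy] := boolP (le x y); last by exists true.
    by exists false => //=; apply: anti; rewrite yx xy.
  have : [set: K] #<= [set y | ~~ le x y].
    by apply: contrapT => n; apply: sx; split => //; exact: card_leT.
  move=> h; apply: card_le_trans h _; apply: subset_card_le => y /negP xy.
  by apply: contrapT => /mx0.
have [h Wh inj_h] := card_leT_ex k0 KW.
apply/(card_leTPex k0); exists (fun p => g (h p.1, h p.2)) => -[a b] [c d] _ _.
move=> /inj_g; rewrite !inE => /(_ (conj (Wh _) (Wh _)) (conj (Wh _) (Wh _))).
by move=> [/inj_h -> /inj_h ->].
Qed.

(** A point [x] is coded by the pair of a chosen index [j] with [x] in [F j] and the code of [x] in
    [F j]. Equal codes share the index, and the coding of that one set is injective. *)
Lemma bigcup_card_le (K I X : Type) (D : set I) (F : I -> set X) :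
  [set: (K * K)%type] #<= [set: K] ->
  D #<= [set: K] -> (forall i, D i -> F i #<= [set: K]) ->
  \bigcup_(i in D) F i #<= [set: K].
Proof.
move=> KK DK FK; have [[k0]|nK] := pselect (inhabited K); last first.
  have K0 : [set: K] = set0 by apply/seteqP; split=> // k; case: nK.
  have /card_le0P D0 : D #<= @set0 K by rewrite -K0.
  by rewrite D0 bigcup_set0.
have [p pI] := (card_leTPex k0 _).1 KK; have [d dI] := (card_leTPex k0 _).1 DK.
have /choice[f fI] : forall i,
    exists f : X -> K, D i -> {in F i &, injective f}.
  move=> i; have [Di|nDi] := pselect (D i); last by exists (fun=> k0).
  by have [f ?] := (card_leTPex k0 _).1 (FK i Di); exists f.
have g x : exists k, forall i, D i -> F i x ->
    exists j, [/\ D j, F j x & k = p (d j, f j x)].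
  have [[i [Di Fix]]|nx] := pselect (exists i, D i /\ F i x).
    by exists (p (d i, f i x)) => _ _ _; exists i.
  by exists k0 => i Di Fix; exfalso; apply: nx; exists i.
have {g}[g gP] := choice g.
apply/(card_leTPex k0); exists g => x y /set_mem[i Di Fix] /set_mem[j Dj Fjy].
have [i' [Di' Fi'x ->]] := gP x i Di Fix.
have [j' [Dj' Fj'y ->]] := gP y j Dj Fjy.
move=> /pI; rewrite !inE => /(_ Logic.I Logic.I)[/dI].
rewrite !inE => /(_ Di' Dj') ij.
by move: Fj'y; rewrite -ij => Fi'y /(fI i' Di'); rewrite !inE; exact.
Qed.

(** * Cardinality of the syntax *)

(** Proof irrelevance trivialises the equation between the first components, so this holds over an
    arbitrary type [X]. *)
Lemma existT_inj (X : Type) (P : X -> Type) (x : X) : injective (existT P x).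
Proof.
move=> u v e; have := projT2_eq e.
by rewrite (Prop_irrelevance (projT1_eq e) erefl).
Qed.

(** All sorts are taken together so that extending the context adds exactly one position; a single
    fibre is embedded in the sum afterwards. *)
Lemma finite_var_sig (X : Type) (G : seq X) : finite_set [set: {A & var G A}].
Proof.
elim: G => [|B G IH].
  apply: sub_finite_set (finite_set0 _) => -[A v] _; exact: var_nil v.
apply: (@sub_finite_set _ _ ([set existT _ B (VZ B G)] `|`
    (fun x => existT (var (B :: G)) _ (VS B (projT2 x))) @`
      [set: {A & var G A}])).
  case=> A v _; elim/var_cons_ind: v; first by left.
  by move=> A' v; right; exists (existT _ A' v).
by rewrite finite_setU; split; [exact: finite_set1|exact: finite_image].
Qed.

Lemma finite_var (X : Type) (G : seq X) (A : X) : finite_set [set: var G A].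
Proof.
have inj_ex : {in [set: var G A] &, injective (existT (var G) A)}.
  by move=> u v _ _; exact: existT_inj.
have := inj_card_eq inj_ex; rewrite card_eq_sym => /card_eqPle[le _].
exact: card_le_finite le (sub_finite_set (@subsetT _ _) (finite_var_sig G)).
Qed.

Section Small.
Context (K : Type) (infK : infinite_set [set: K])
  (KK : [set: (K * K)%type] #<= [set: K]).
Local Notation small A := (A #<= [set: K]).

Lemma small_finite (X : Type) (A : set X) : finite_set A -> small A.
Proof. by move=> /(finite_card_lt infK)[]. Qed.

Lemma small_set1 (X : Type) (x : X) : small [set x].
Proof. exact/small_finite/finite_set1. Qed.

Lemma small_setU (X : Type) (A B : set X) : small A -> small B -> small (A `|` B).
Proof.
move=> sA sB; rewrite -bigcup2E; apply: bigcup_card_le => //.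
  by apply: card_le_trans (card_leT _) _; exact/infiniteP.
by move=> [|[|n]] _ //=; exact: card_ge0.
Qed.

Lemma small_bigcup_nat (X : Type) (F : nat -> set X) :
  (forall n, small (F n)) -> small (\bigcup_n F n).
Proof. by move=> sF; apply: bigcup_card_le => //; exact/infiniteP. Qed.

Lemma small_image (X Y : Type) (f : X -> Y) (A : set X) :
  small A -> small (f @` A).
Proof. exact: card_le_trans (card_image_le _ _). Qed.

Lemma small_sub (X : Type) (A B : set X) : A `<=` B -> small B -> small A.
Proof. by move=> /subset_card_le; exact: card_le_trans. Qed.

(** Meant for the equations [fcod f = A] that index a union in [terms_to]. *)
Lemma small_proof (P : Prop) : small [set: P].
Proof.
apply: small_finite; have [p|np] := pselect P.
  by apply: sub_finite_set (finite_set1 p) => q _; exact: Prop_irrelevance.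
by apply: sub_finite_set (finite_set0 _) => q; case: np.
Qed.

Lemma small_seq (X : Type) : small [set: X] -> small [set: seq X].
Proof.
move=> sX; suff sS n : small [set s : seq X | size s = n].
  apply: small_sub (small_bigcup_nat sS) => s _; by exists (size s).
elim: n => [|n IH].
  by apply: small_sub (small_set1 [::]) => -[].
apply: (@small_sub _ _ (\bigcup_(x in [set: X]) cons x @` [set s | size s = n])).
  by move=> [//|x s] [sz]; exists x => //; exists s.
by apply: bigcup_card_le => // x _; exact: small_image.
Qed.

Context (L : language) (sL : small [set: (symbols L + nat)%type]).

Lemma small_of_inj (X Y : Type) (f : X -> Y) :
  injective f -> small [set: Y] -> small [set: X].
Proof.
move=> inj_f; apply: card_le_trans.
have fI : {in [set: X] &, injective f} by move=> x y _ _; exact: inj_f.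
apply: card_le_trans (card_leT (f @` setT)).
by have := inj_card_eq fI; rewrite card_eq_sym => /card_eqPle[].
Qed.

Lemma small_sorts : small [set: sorts L].
Proof.
by apply: (@small_of_inj _ _
  (fun A => inl (inl A) : (symbols L + nat)%type)) sL => ? ? [].
Qed.

Lemma small_fsym : small [set: Defs.fsym L].
Proof.
apply: (@small_of_inj _ _
  (fun f => inl (inr (inl f)) : (symbols L + nat)%type)) sL.
by move=> ? ? [].
Qed.

Lemma small_rsym : small [set: rsym L].
Proof.
apply: (@small_of_inj _ _
  (fun r => inl (inr (inr r)) : (symbols L + nat)%type)) sL.
by move=> ? ? [].
Qed.

Fixpoint args_over (G : seq (sorts L)) (X : forall A, set (term G A)) D :
    set (args G D) :=
  match D return set (args G D) with
  | [::] => [set ANil G]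
  | A :: D' => \bigcup_(t in X A) (ACons t @` @args_over G X D')
  end.

(** Strata of bounded height: each is a small union of images of earlier ones, which counts the
    syntax without coding it by strings. The equation [e] is an index because [App] only produces
    terms of sort [fcod f]. *)
Fixpoint terms_to (n : nat) (G : seq (sorts L)) A : set (term G A) :=
  if n is n'.+1 then
    (range (@Var L G A)) `|` \bigcup_f \bigcup_(e : fcod f = A)
      [set eq_rect _ (term G) (App ts) _ e |
        ts in @args_over G (@terms_to n' G) (fdom f)]
  else set0.

Fixpoint formulas_to (n : nat) (G : seq (sorts L)) : set (formula G) :=
  if n is n'.+1 then
    [set Top] `|` (\bigcup_r range (@Rel L G r) `|`
    (\bigcup_A \bigcup_(t : term G A) range (Eq t) `|`
    (\bigcup_(p in @formulas_to n' G) (And p @` @formulas_to n' G) `|`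
    (@Not L G @` @formulas_to n' G `|`
     \bigcup_A (@Ex L G A @` @formulas_to n' (A :: G))))))
  else set0.

Lemma args_over_sub G (X Y : forall A, set (term G A)) D :
  (forall A, X A `<=` Y A) -> @args_over G X D `<=` @args_over G Y D.
Proof.
move=> XY; elim: D => [|A D IH] //= ts [t Xt [ts' Xts' <-]].
by exists t; [exact: XY|exists ts' => //; exact: IH].
Qed.

Lemma terms_to_leq n m G A : (n <= m)%N -> @terms_to n G A `<=` @terms_to m G A.
Proof.
elim: n m A => [m A _ t []|n IH [|m] A //= nm t].
case=> [?|[f _ [e _ [ts tsP <-]]]]; [by left|right].
exists f => //; exists e => //; exists ts => //.
by apply: args_over_sub tsP => B; exact: IH.
Qed.

Lemma formulas_to_leq n m G :
  (n <= m)%N -> @formulas_to n G `<=` @formulas_to m G.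
Proof.
elim: n m G => [m G _ p []|n IH [|m] G //= nm].
apply: setUSS => //; apply: setUSS => //; apply: setUSS => //.
have IHn D := IH m D nm.
apply: setUSS; last apply: setUSS; last 2 first.
- exact: image_subset.
- by move=> p [A _ [q /IHn qP <-]]; exists A => //; exists q.
- by move=> p [q /IHn qP [r /IHn rP <-]]; exists q => //; exists r.
Qed.

Lemma terms_to_all G A (t : term G A) : exists n, terms_to n t.
Proof.
move: A t; apply: (@term_args_ind L G (fun A t => exists n, terms_to n t)
  (fun D ts => exists n, args_over (@terms_to n G) ts)).
- by move=> A v; exists 1; left; exists v.
- move=> f ts [n tsP]; exists n.+1; right; exists f => //.
  by exists erefl => //; exists ts.
- by exists 0.
- move=> A D t [n tP] ts [m tsP]; exists (maxn n m), t.
    by apply: terms_to_leq tP; exact: leq_maxl.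
  exists ts => //; apply: args_over_sub tsP => B.
  by apply: terms_to_leq; exact: leq_maxr.
Qed.

Lemma formulas_to_all G (p : formula G) : exists n, formulas_to n p.
Proof.
elim: p => {G}.
- by move=> G r ts; exists 1; right; left; exists r => //; exists ts.
- move=> G A t s; exists 1; right; right; left; exists A => //.
  by exists t => //; exists s.
- by move=> G; exists 1; left.
- move=> G p [n pP] q [m qP]; exists (maxn n m).+1; right; right; right; left.
  exists p; first by apply: formulas_to_leq pP; exact: leq_maxl.
  by exists q => //; apply: formulas_to_leq qP; exact: leq_maxr.
- by move=> G p [n pP]; exists n.+1; right; right; right; right; left; exists p.
- move=> G A p [n pP]; exists n.+1; right; right; right; right; right.
  by exists A => //; exists p.
Qed.

Lemma small_args_over G (X : forall A, set (term G A)) D :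
  (forall A, small (X A)) -> small (@args_over G X D).
Proof.
move=> sX; elim: D => [|A D IH] /=; first exact: small_set1.
by apply: bigcup_card_le => // t _; exact: small_image.
Qed.

Lemma small_terms (G : seq (sorts L)) A : small [set: term G A].
Proof.
apply: (@small_sub _ _ (\bigcup_n @terms_to n G A)).
  by move=> t _; have [n] := terms_to_all t; exists n.
apply: small_bigcup_nat => n; elim: n A => [|n IH] A /=; first exact: card_ge0.
apply: small_setU; first exact/small_image/small_finite/finite_var.
apply: bigcup_card_le => // [|f _]; first exact: small_fsym.
apply: bigcup_card_le => // [|e _]; first exact: small_proof.
exact/small_image/small_args_over.
Qed.

Lemma small_args (G D : seq (sorts L)) : small [set: args G D].
Proof.
apply: (@small_sub _ _ (@args_over G (fun A => [set: @term L G A]) D)).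
  by move=> ts _; elim: ts => //= A D' t ts; exists t => //; exists ts.
by apply: small_args_over => A; exact: small_terms.
Qed.

Lemma small_formulas (G : seq (sorts L)) : small [set: formula G].
Proof.
apply: (@small_sub _ _ (\bigcup_n @formulas_to n G)).
  by move=> p _; have [n] := formulas_to_all p; exists n.
apply: small_bigcup_nat => n; elim: n G => [|n IH] G /=; first exact: card_ge0.
apply: small_setU; first exact: small_set1.
apply: small_setU.
  apply: bigcup_card_le => // [|r _]; first exact: small_rsym.
  exact/small_image/small_args.
apply: small_setU.
  apply: bigcup_card_le => // [|A _]; first exact: small_sorts.
  apply: bigcup_card_le => // [|t _]; first exact: small_terms.
  exact/small_image/small_terms.
apply: small_setU.
  by apply: bigcup_card_le => // p _; exact: small_image.
apply: small_setU; first exact: small_image.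
apply: bigcup_card_le => // [|A _]; first exact: small_sorts.
exact: small_image.
Qed.

End Small.

(** * Compactness with labelled models *)

Fixpoint ptab (S : Type) (X : S -> Type) (G : seq S) :
    (forall A, var G A -> X A) -> prods X G :=
  match G return (forall A, var G A -> X A) -> prods X G with
  | [::] => fun _ => tt
  | A :: G' => fun f => (f A (VZ A G'), ptab (fun B v => f B (VS A v)))
  end.

Lemma plookup_tab (S : Type) (X : S -> Type) (G : seq S)
    (f : forall A, var G A -> X A) A (v : var G A) : plookup v (ptab f) = f A v.
Proof. by elim: v f => //= ? ? ? ? IH f; rewrite IH. Qed.

Lemma plookup_map (S : Type) (X Y : S -> Type) (f : forall A, X A -> Y A)
    (G : seq S) (a : prods X G) A (v : var G A) :
  plookup v (pmap_prods f a) = f A (plookup v a).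
Proof. by elim: v a => //= ? ? ? ? IH a; rewrite IH. Qed.

Fixpoint vargs (L : language) (D E : seq (sorts L)) :
    (forall A, var D A -> var E A) -> args E D :=
  match D return (forall A, var D A -> var E A) -> args E D with
  | [::] => fun _ => ANil E
  | A :: D' => fun r =>
      ACons (Var (r _ (VZ A D'))) (vargs (fun B v => r _ (VS A v)))
  end.

Lemma aeval_vargs (L : language) (M : structure L) (D E : seq (sorts L))
    (r : forall A, var D A -> var E A) (a : prods M E) (b : prods M D) :
  agree r a b -> aeval (vargs r) a = b.
Proof.
elim: D r b => [|A D IH] r; first by case.
case=> x b ab /=; rewrite (IH _ b) => [|B v]; last exact: (ab _ (VS A v)).
by rewrite -(ab _ (VZ A D)).
Qed.

(** * The theorem of Los for the Skolem hull of a point in an ultraproduct *)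

Section Ultraproduct.
Context (L : language) (I : Type) (U : set_system I) {UU : UltraFilter U}.
Context (M : I -> structure L) (G : seq (sorts L)) (a : forall i, prods (M i) G).

(* Sorts may be empty in some of the [M i], hence partial functions. *)
Definition pfun A := forall i, option (M i A).

Fixpoint pvals D (s : prods pfun D) i : option (prods (M i) D) :=
  match D return prods pfun D -> option (prods (M i) D) with
  | [::] => fun _ => Some tt
  | A :: D' => fun s =>
      match s.1 i, pvals s.2 i with
      | Some x, Some b => Some (x, b)
      | _, _ => None
      end
  end s.

(** The Skolem function of [Ex p], computed factor by factor. *)
Definition witness A D (p : formula (A :: D)) (s : prods pfun D) : pfun A :=
  fun i =>
    if pselect (exists x, exists2 b, pvals s i = Some b &
      @sat L (M i) (A :: D) p (x, b))
    is left e then Some (projT1 (cid e)) else None.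

Lemma witnessP A D (p : formula (A :: D)) (s : prods pfun D) i b x :
  pvals s i = Some b -> @sat L (M i) (A :: D) p (x, b) ->
  exists2 y, witness p s i = Some y & @sat L (M i) (A :: D) p (y, b).
Proof.
move=> sb px; rewrite /witness; case: pselect => [e|[]]; last by exists x, b.
by exists (projT1 (cid e)) => //; case: cid => y /= [b']; rewrite sb => -[<-].
Qed.

Fixpoint all_in (X : forall A, set (pfun A)) D : set (prods pfun D) :=
  match D return set (prods pfun D) with
  | [::] => setT
  | A :: D' => [set s | X A s.1 /\ @all_in X D' s.2]
  end.

(** Stages of the closure of the coordinates of [a] under Skolem functions. Operations of the
    language are covered as Skolem functions of their graphs. *)
Fixpoint hull_to (n : nat) A : set (pfun A) :=
  if n is n'.+1 then
    @hull_to n' A `|` \bigcup_D \bigcup_(p : formula (A :: D))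
      (witness p @` @all_in (@hull_to n') D)
  else range (fun (v : var G A) i => Some (plookup v (a i))).

Definition hull A : set (pfun A) := \bigcup_n @hull_to n A.

Lemma hull_to_leq n m A : (n <= m)%N -> @hull_to n A `<=` @hull_to m A.
Proof.
elim: m => [|m IH]; first by rewrite leqn0 => /eqP ->.
by rewrite leq_eqVlt => /orP[/eqP -> //|/IH nm] x /nm; left.
Qed.

Lemma all_in_sub (X Y : forall A, set (pfun A)) D :
  (forall A, X A `<=` Y A) -> @all_in X D `<=` @all_in Y D.
Proof. by move=> XY; elim: D => //= A D IH s [/XY ? /IH]. Qed.

Lemma all_in_hull D (s : prods pfun D) :
  all_in hull s -> exists n, all_in (@hull_to n) s.
Proof.
elim: D s => [|A D IH] /= s; first by exists 0.
move=> [[n _ sn] /IH[m sm]]; exists (maxn n m); split.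
  by apply: hull_to_leq sn; exact: leq_maxl.
by apply: all_in_sub sm => B; apply: hull_to_leq; exact: leq_maxr.
Qed.

Lemma hull_witness A D (p : formula (A :: D)) (s : prods pfun D) :
  all_in hull s -> hull (witness p s).
Proof.
by move=> /all_in_hull[n sn]; exists n.+1 => //; right; exists D => //;
  exists p => //; exists s.
Qed.

Section SmallHull.
Context (K : Type) (infK : infinite_set [set: K])
  (KK : [set: (K * K)%type] #<= [set: K])
  (sL : [set: (symbols L + nat)%type] #<= [set: K]).

Lemma small_all_in (X : forall A, set (pfun A)) D :
  (forall A, X A #<= [set: K]) -> @all_in X D #<= [set: K].
Proof.
move=> sX; elim: D => [|A D IH] /=.
  by apply: small_sub (small_set1 infK tt) => -[].
apply: (@small_sub _ _ _ (\bigcup_(x in X A) (pair x @` @all_in X D))).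
  by move=> [x s] [/= Xx Xs]; exists x => //; exists s.
by apply: bigcup_card_le => // x _; exact: small_image.
Qed.

Lemma small_hull A : @hull A #<= [set: K].
Proof.
apply: small_bigcup_nat => // n; elim: n A => [|n IH] A /=.
  exact/small_image/small_finite/finite_var.
apply: small_setU => //.
apply: bigcup_card_le => // [|D _].
  exact/small_seq/small_sorts.
apply: bigcup_card_le => // [|p _]; first exact: small_formulas.
exact/small_image/small_all_in.
Qed.
End SmallHull.

Definition pelt A : Type :=
  {x : pfun A | @hull A x /\ \forall i \near U, exists c, x i = Some c}.

Definition near_eq A (x y : pelt A) : Prop :=
  \forall i \near U, sval x i = sval y i.

(* Not [set (pelt A)], whose universe is above that of the carriers of
   structures. *)
Definition ucarrier A : Type :=
  {c : pelt A -> Prop | exists x, c = @near_eq A x}.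

Definition ucls A (x : pelt A) : ucarrier A :=
  exist _ (@near_eq A x) (ex_intro _ x erefl).

Lemma ucls_eq A (x y : pelt A) : ucls x = ucls y <-> near_eq x y.
Proof.
split=> [xy|xy].
  suff : near_eq y y by have -> : near_eq x = near_eq y := f_equal sval xy.
  exact: nearW.
apply: eq_exist; apply/funext => z; apply/propext.
by split; apply: filterS2 xy => i -> ->.
Qed.

Lemma ucls_surj A (c : ucarrier A) : exists x, ucls x = c.
Proof. by case: c => c [x cx]; exists x; exact: eq_exist. Qed.

Definition urepr A (c : ucarrier A) : pelt A := projT1 (cid (ucls_surj c)).

Lemma ureprK A (c : ucarrier A) : ucls (urepr c) = c.
Proof. by rewrite /urepr; case: cid. Qed.

Definition uvals D (s : prods pelt D) i : option (prods (M i) D) :=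
  pvals (pmap_prods (fun A (x : pelt A) => sval x) s) i.

Lemma uvals_near D (s : prods pelt D) :
  \forall i \near U, exists b, uvals s i = Some b.
Proof.
elim: D s => [|A D IH] s; first by apply: nearW => i; exists tt.
case: s => x s; apply: filterS2 (svalP x).2 (IH s) => i [c xc] [b sb].
by exists (c, b); rewrite /uvals /= xc; move: sb; rewrite /uvals => ->.
Qed.

Lemma uvals_cons A D (x : pelt A) (s : prods pelt D) i c :
  @uvals (A :: D) (x, s) i = Some c <->
  sval x i = Some c.1 /\ uvals s i = Some c.2.
Proof.
rewrite /uvals /=; case: c => c b /=; case: (sval x i) => [c'|]; last first.
  by split=> // -[].
case: (pvals _ i) => [b'|]; last by split=> // -[].
by split=> [[-> ->]|[[->] [->]]].
Qed.

Lemma uvals_in D (s : prods pelt D) :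
  all_in hull (pmap_prods (fun A (x : pelt A) => sval x) s).
Proof. by elim: D s => [|A D IH] //= s; split => //; exact: (svalP s.1).1. Qed.

Lemma uvals_eq D (s t : prods pelt D) :
  pmap_prods ucls s = pmap_prods ucls t ->
  \forall i \near U, uvals s i = uvals t i.
Proof.
elim: D s t => [|A D IH] s t; first by move=> _; exact: nearW.
case: s t => [x s] [y t] /= e.
have /ucls_eq xy := f_equal fst e; have /IH st := f_equal snd e.
by apply: filterS2 xy st => i; rewrite /uvals /= => -> ->.
Qed.

(** The hypothesis makes the Skolem function defined almost everywhere, hence an element of the
    hull. It then supplies a witness at every index where one exists. *)
Lemma uwitness_near A D (p : formula (A :: D)) (s : prods pelt D) :
  (\forall i \near U, exists2 b, uvals s i = Some b &
     exists x, @sat L (M i) (A :: D) p (x, b)) ->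
  exists y : pelt A, forall i b x, uvals s i = Some b ->
    @sat L (M i) (A :: D) p (x, b) ->
    exists2 c, sval y i = Some c & @sat L (M i) (A :: D) p (c, b).
Proof.
move=> px; pose w := witness p (pmap_prods (fun A (x : pelt A) => sval x) s).
have wP : @hull A w /\ \forall i \near U, exists c, w i = Some c.
  split; first exact/hull_witness/uvals_in.
  apply: filterS px => i [b sb [x pxb]].
  by have [y wy _] := witnessP sb pxb; exists y.
by exists (exist _ w wP) => i b x sb pxb; exact: witnessP sb pxb.
Qed.

(** Through this formula, closure under Skolem functions yields closure under [f]. *)
Definition graph (f : Defs.fsym L) : formula (fcod f :: fdom f) :=
  Eq (Var (VZ (fcod f) (fdom f))) (App (vargs (fun A v => VS (fcod f) v))).

Lemma sat_graph (N : structure L) f x (b : prods N (fdom f)) :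
  @sat L N (fcod f :: fdom f) (graph f) (x, b) <-> x = fint b.
Proof. by rewrite /= (aeval_vargs (b := b)) // => A v. Qed.

Lemma uapp_ex f (s : prods pelt (fdom f)) : exists y : pelt (fcod f),
  forall i b, uvals s i = Some b -> sval y i = Some (fint b).
Proof.
have [|y yP] := @uwitness_near _ _ (graph f) s.
  apply: filterS (uvals_near s) => i [b sb]; exists b => //.
  by exists (fint b); apply/sat_graph.
exists y => i b sb; have [|c yc] := yP i b (fint b) sb; first exact/sat_graph.
by move=> /sat_graph <-.
Qed.

Definition uapp f (s : prods pelt (fdom f)) : pelt (fcod f) :=
  projT1 (cid (uapp_ex s)).

Lemma uappE f (s : prods pelt (fdom f)) i b :
  uvals s i = Some b -> sval (uapp s) i = Some (fint b).
Proof. by rewrite /uapp; case: cid => y yP; exact: yP. Qed.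

(* The Skolem hull of the components of [a] in the ultraproduct of the [M i]. *)
Definition ustructure : structure L := @Structure L ucarrier
  (fun f c => ucls (uapp (pmap_prods urepr c)))
  (fun r c => \forall i \near U,
     exists2 b, uvals (pmap_prods urepr c) i = Some b & rint b).

Lemma uvals_repr D (s : prods pelt D) :
  \forall i \near U, uvals (pmap_prods urepr (pmap_prods ucls s)) i = uvals s i.
Proof.
apply: uvals_eq; rewrite -pmap_prods_comp; apply: plookup_inj => A v.
by rewrite !plookup_map ureprK.
Qed.

Definition upoint D (s : prods pelt D) : prods ustructure D := pmap_prods ucls s.

(** The case of terms in the theorem of Los. The claim is conditional on [uvals s i = Some b] since
    [s] is defined only almost everywhere. *)
Lemma teval_u D (s : prods pelt D) A (t : term D A) :
  exists y : pelt A, teval t (upoint s) = ucls y /\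
    \forall i \near U, forall b, uvals s i = Some b ->
      sval y i = Some (teval t b).
Proof.
move: A t; apply: (@term_args_ind L D
  (fun A t => exists y : pelt A, teval t (upoint s) = ucls y /\
    \forall i \near U, forall b, uvals s i = Some b ->
      sval y i = Some (teval t b))
  (fun E ts => exists ys : prods pelt E, aeval ts (upoint s) = upoint ys /\
    \forall i \near U, forall b, uvals s i = Some b ->
      uvals ys i = Some (aeval ts b))).
- move=> A v; exists (plookup v s); split; first exact: plookup_map.
  apply: nearW => i; elim: v s => [A' D' [x s] [c b]|A' B D' v IH [x s] [c b]].
    by move=> /uvals_cons[].
  by move=> /uvals_cons[/= _ sb]; exact: IH.
- move=> f ts [ys [tsE ysP]].
  exists (uapp (pmap_prods urepr (pmap_prods ucls ys))); rewrite /= tsE; split=> //.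
  apply: filterS2 ysP (uvals_repr ys) => i ysi yse b /ysi yb.
  by apply: uappE; rewrite yse.
- by exists tt; split=> //; exact: nearW.
- move=> A E t [y [tE yP]] ts [ys [tsE ysP]]; exists (y, ys); split.
    by rewrite /= tE tsE.
  apply: filterS2 yP ysP => i yi ysi b sb.
  by apply/(@uvals_cons A E); rewrite (yi b sb) (ysi b sb).
Qed.

Lemma aeval_u D (s : prods pelt D) E (ts : args D E) :
  exists ys : prods pelt E, aeval ts (upoint s) = upoint ys /\
    \forall i \near U, forall b, uvals s i = Some b ->
      uvals ys i = Some (aeval ts b).
Proof.
elim: ts => [|A E' t ts [ys [tsE ysP]]].
  by exists tt; split=> //; exact: nearW.
have [y [tE yP]] := teval_u s t; exists (y, ys); split; first by rewrite /= tE tsE.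
apply: filterS2 yP ysP => i yi ysi b sb.
by apply/(@uvals_cons A E'); rewrite (yi b sb) (ysi b sb).
Qed.

(** Induction on [p]: negation uses that [U] contains a set or its complement, and the quantifier
    uses the Skolem witnesses of [uwitness_near], which stay in the hull. *)
Lemma los D (p : formula D) (s : prods pelt D) :
  sat p (upoint s) <->
  \forall i \near U, exists2 b, uvals s i = Some b & sat p b.
Proof.
elim: p s => {D}.
- move=> D r ts s /=; have [ys [-> ysP]] := aeval_u s ts; rewrite /=.
  split=> [rys|rts].
    apply: filterS3 (uvals_repr ys) (filterI rys (uvals_near s)) ysP.
    move=> i yse [[c]]; rewrite yse => yc rc [b sb] /(_ b sb).
    by rewrite yc => -[cb]; exists b => //; rewrite -cb.
  apply: filterS3 (uvals_repr ys) rts ysP => i yse [b sb rb] /(_ b sb) yb.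
  by exists (aeval ts b) => //; rewrite yse.
- move=> D A t u s /=; have [y [-> yP]] := teval_u s t.
  have [z [-> zP]] := teval_u s u; rewrite ucls_eq; split=> [yz|tu].
    apply: filterS3 (filterI yz (uvals_near s)) yP zP.
    move=> i [yzi [b sb]] /(_ b sb) yb /(_ b sb) zb; exists b => //.
    by move: yzi; rewrite yb zb => -[].
  apply: filterS3 tu yP zP => i [b sb tub] /(_ b sb) yb /(_ b sb) zb.
  by rewrite yb zb tub.
- move=> D s; split=> // _; apply: filterS (uvals_near s) => i [b sb].
  by exists b.
- move=> D p IHp q IHq s /=; rewrite IHp IHq; split=> [[]|].
    by apply: filterS2 => i [b sb pb] [c]; rewrite sb => -[<-] qb; exists b.
  by move=> pq; split; apply: filterS pq => i [b sb [pb qb]]; exists b.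
- move=> D p IHp s /=; rewrite IHp; split=> [np|np pp].
    have [//|nU] := in_ultra_setVsetC
      [set i | exists2 b, uvals s i = Some b & sat p b] UU.
    apply: filterS2 nU (uvals_near s) => i /= nb [b sb]; exists b => // pb.
    by apply: nb; exists b.
  have [i [[b sb nb] [c]]] := filter_ex (filterI np pp).
  by rewrite sb => -[<-].
- move=> D A p IHp s /=; split=> [[x]|px].
    rewrite -[x]ureprK; move/(IHp (urepr x, s)).
    apply: filterS => i [[c b] /uvals_cons[/= xc sb] pb].
    by exists b => //; exists c.
  have [y yP] := uwitness_near px; exists (ucls y); apply/(IHp (y, s)).
  apply: filterS px => i [b sb [x pb]]; have [c yc pc] := yP i b x sb pb.
  by exists (c, b) => //; apply/uvals_cons.
Qed.

Lemma gen_in A (v : var G A) :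
  @hull A (fun i => Some (plookup v (a i))) /\
  \forall i \near U, exists c, Some (plookup v (a i)) = Some c.
Proof.
split; first by exists 0 => //; exists v.
by apply: nearW => i; exists (plookup v (a i)).
Qed.

Lemma los_gen : exists c : prods ustructure G, forall p : formula G,
  (\forall i \near U, sat p (a i)) -> sat p c.
Proof.
pose s : prods pelt G := ptab (fun A v => exist _ _ (gen_in v)).
suff sa i : uvals s i = Some (a i).
  exists (upoint s) => p pa; apply/los; apply: filterS pa => i pai.
  by exists (a i).
(* Only the coordinates of [s] are kept, so that the induction on [G] can run over arbitrary [s]. *)
have {}sa A (v : var G A) : sval (plookup v s) i = Some (plookup v (a i)).
  by rewrite plookup_tab.
elim: G (a i) s sa => [[]|A D IH b s sa] //.
case: s sa => x s sa; apply/uvals_cons; split; first exact: (sa _ (VZ A D)).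
by apply: IH => B v; exact: (sa _ (VS A v)).
Qed.

Lemma small_ustructure (K : Type) A :
  infinite_set [set: K] -> [set: (K * K)%type] #<= [set: K] ->
  [set: (symbols L + nat)%type] #<= [set: K] ->
  [set: ustructure A] #<= [set: K].
Proof.
move=> infK KK sL.
have sP : [set: pelt A] #<= [set: K].
  have fI : {in [set: pelt A] &, injective (fun x => sval x)}.
    by move=> [x xP] [y yP] _ _ /= xy; exact: eq_exist.
  have := inj_card_eq fI; rewrite card_eq_sym => /card_eqPle[le _].
  apply: card_le_trans le _; apply: small_sub (small_hull infK KK sL A).
  by move=> _ [x _ <-]; exact: (svalP x).1.
apply: small_sub (small_image (@ucls A) sP) => c _.
by have [x xc] := ucls_surj c; exists x.
Qed.

End Ultraproduct.

(** Embed [X * K] in [K] and label the code of [(x, y)] by [x]: the fibre of [x] contains a copy of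
    [K]. Elements of [K] that are not codes remain unlabelled. *)
Lemma labelling_exists (K X : Type) :
  infinite_set [set: K] -> [set: (K * K)%type] #<= [set: K] ->
  [set: X] #<= [set: K] ->
  exists f : K -> option X, forall x, infinite_set [set k | f k = Some x].
Proof.
move=> infK KK sX; have [k0 _] := infinite_setN0 infK.
have [p pI] := (card_leTPex k0 _).1 KK; have [h hI] := (card_leTPex k0 _).1 sX.
have pI' x y x' y' : p (h x, y) = p (h x', y') -> x = x' /\ y = y'.
  by move=> /pI; rewrite !inE => /(_ Logic.I Logic.I)[/hI]; rewrite !inE => ->.
exists (fun k => if pselect (exists x y, p (h x, y) = k) is left e
  then Some (projT1 (cid e)) else None) => x.
apply: (@sub_infinite_set _ (range (fun y => p (h x, y)))).
  move=> _ [y _ <-] /=; case: pselect => [e|[]]; last by exists x, y.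
  by case: cid => /= x' [y' /pI'[-> _]].
have inj_px : {in [set: K] &, injective (fun y => p (h x, y))}.
  by move=> y y' _ _ /pI'[].
have := inj_card_eq inj_px; rewrite card_eq_sym => /card_eqPle[le _] fin.
by apply: infK; exact: card_le_finite le fin.
Qed.

(** The factors are indexed by the finite lists of formulas from [Gam], and the ultrafilter contains
    the cone of all lists extending a given one. *)
Theorem compactness (L : language) (K : Type) (T : set (sentence L))
    (G : seq (sorts L)) (Gam : set (formula G)) :
  regular_cardinal K -> [set: (symbols L + nat)%type] #<= [set: K] ->
  (forall s : seq {classic formula G}, (forall p, p \in s -> Gam p) ->
    exists (mu : lmodel T K) (a : prods mu G), forall p, p \in s -> sat p a) ->
  exists (mu : lmodel T K) (a : prods mu G), forall p, Gam p -> sat p a.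
Proof.
move=> regK sL fin; have infK := regK.1; have KK := regular_square regK.
(* [{classic _}] only occurs in the predicate: as the type of the elements of [s]
   it would put [I] in a universe above that of the carriers of structures. *)
pose I := {s : seq (formula G) |
  forall p, p \in (s : seq {classic formula G}) -> Gam p}.
have /choice[f fP] : forall i : I, exists x : {mu : lmodel T K & prods mu G},
    forall p : formula G,
      p \in (sval i : seq {classic formula G}) -> sat p (projT2 x).
  by move=> [s /[dup] /fin[mu [a aP]] sG]; exists (existT _ mu a).
pose B (i : I) : set I := [set j |
  {subset (sval i : seq {classic formula G}) <=
    (sval j : seq {classic formula G})}].
have nilP p : p \in ([::] : seq {classic formula G}) -> Gam p by [].
have FB : ProperFilter (filter_from setT B).
  apply: filter_from_proper; last by move=> i _; exists i.
  apply: filter_from_filter; first by exists (exist _ _ nilP).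
  move=> i j _ _.
  (* The cone over the concatenation lies in both cones. *)
  have ijP p : p \in (sval i ++ sval j : seq {classic formula G}) -> Gam p.
    by rewrite mem_cat => /orP[/(svalP i)|/(svalP j)].
  exists (exist _ _ ijP) => // k ijk; split=> p pi; apply: ijk => /=.
    by rewrite mem_cat pi.
  by rewrite mem_cat pi orbT.
have [U [UU FU]] := ultraFilterLemma FB.
pose M i : structure L := projT1 (f i).
pose a i : prods (M i) G := projT2 (f i).
pose N : structure L := @ustructure L I U UU M G a.
have [lab labP] : exists lab : forall A, K -> option (N A),
    forall A x, infinite_set [set k | lab A k = Some x].
  have /all_sig[lab labP] : forall A, {lab : K -> option (N A) |
      forall x, infinite_set [set k | lab k = Some x]}.
    move=> A; apply: cid; apply: labelling_exists => //.
    exact: small_ustructure.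
  by exists lab.
have NT (p : sentence L) : T p -> @sat L N [::] p tt.
  move=> Tp; apply/(@los L I U UU M G a [::] p tt); apply: nearW => i.
  by exists tt => //; exact: modelP.
have [c cP] := @los_gen L I U UU M G a.
exists (@LModel L T K N NT lab labP), c => p Gp; apply: cP.
(* The cone over the one-element list of [p] belongs to [U], and [p] holds throughout it. *)
have pP q : q \in ([:: p] : seq {classic formula G}) -> Gam q.
  by rewrite inE => /eqP ->.
apply: FU; exists (exist _ _ pP) => // i /= /(_ p) pi; apply: fP.
by apply: pi; rewrite inE.
Qed.

(** * Definable subsheaves *)

Lemma pcat_surj (S : Type) (X : S -> Type) (G D : seq S) (c : prods X (G ++ D)) :
  exists a b, c = pcat a b.
Proof.
elim: G c => [|A G IH] c; first by exists tt, c.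
by case: c => x c; have [a [b ->]] := IH c; exists (x, a), b.
Qed.

Lemma sat_iso (L : language) (M N : structure L) (f : iso M N) G (p : formula G)
    (a : prods M G) : sat p (pmap_prods f a) <-> sat p a.
Proof.
have tevalE D A (t : term D A) (b : prods M D) :
    teval t (pmap_prods f b) = f A (teval t b).
  move: A t; apply: (@term_args_ind L D
    (fun A t => teval t (pmap_prods f b) = f A (teval t b))
    (fun E ts => aeval ts (pmap_prods f b) = pmap_prods f (aeval ts b))) => //=.
  - by move=> A v; exact: plookup_map.
  - by move=> g ts ->; rewrite imap_fint.
  - by move=> A E t -> ts ->.
have aevalE D E (ts : args D E) (b : prods M D) :
    aeval ts (pmap_prods f b) = pmap_prods f (aeval ts b).
  by elim: ts => //= A E' t ts ->; rewrite tevalE.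
elim: p a => /= {G}.
- by move=> G r ts a; rewrite aevalE -(imap_rint f).
- move=> G A t s a; rewrite !tevalE; split=> [|-> //].
  by have inj_f := bij_inj (imap_bij f A); exact: inj_f.
- by [].
- by move=> G p IHp q IHq a; rewrite IHp IHq.
- by move=> G p IHp a; rewrite IHp.
- move=> G A p IHp a; split=> [[y]|[x]].
    have [g _ gK] := imap_bij f A; rewrite -(gK y) => py.
    by exists (g y); apply/(IHp (g y, a)).
  by move=> /(IHp (x, a)); exists (f A x).
Qed.

Fixpoint exs (L : language) (D G : seq (sorts L)) : formula (D ++ G) -> formula G :=
  match D return formula (D ++ G) -> formula G with
  | [::] => id
  | A :: D' => fun p => exs (D := D') (@Ex L (D' ++ G) A p)
  end.

Lemma sat_exs (L : language) (M : structure L) (D G : seq (sorts L))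
    (p : formula (D ++ G)) (a : prods M G) :
  sat (exs p) a <-> exists b : prods M D, sat p (pcat b a).
Proof.
elim: D p => [|A D IH] p /=; first by split=> [pa|[]] //; exists tt.
rewrite IH; split=> [[b [x pb]]|[[x b] pb]]; first by exists (x, b).
by exists b, x.
Qed.

(* [exs] binds a prefix of the context whereas [D] is a suffix: the whole context
   is bound, and its part [G] equated with the free variables. *)
Definition exs_r (L : language) (G D : seq (sorts L)) (p : formula (G ++ D)) :
    formula G :=
  exs (D := G ++ D) (And (fren p (fun A => @vinl _ (G ++ D) G A))
    (eqs (fun A v => @vinl _ (G ++ D) G A (vinl D v))
      (fun A => @vinr _ (G ++ D) G A))).

Lemma sat_exs_r (L : language) (M : structure L) (G D : seq (sorts L))
    (p : formula (G ++ D)) (a : prods M G) :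
  sat (exs_r p) a <-> exists b : prods M D, sat p (pcat a b).
Proof.
have inlP c b : agree (fun A v => @vinl _ (G ++ D) G A (vinl D v))
    (pcat (pcat c b) a) c.
  by move=> A v; rewrite -(agree_inl (pcat c b) a) -(agree_inl c b).
rewrite sat_exs; split=> [[cb]|[b pb]].
  have [c [b ->]] := pcat_surj cb; rewrite /=.
  rewrite (sat_ren p (agree_inl _ _)) (sat_eqs (inlP c b) (agree_inr _ _)).
  by move=> [pb ca]; exists b; rewrite -ca.
exists (pcat a b); split; first by rewrite (sat_ren p (agree_inl _ _)).
by rewrite (sat_eqs (inlP a b) (agree_inr _ _)).
Qed.

Lemma finite_conjunction (L : language) (D : seq (sorts L)) (P : set (formula D)) :
  finite_set P -> exists q : formula D, forall (M : structure L) (b : prods M D),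
    sat q b <-> forall p, P p -> sat p b.
Proof.
move=> /(@finite_seqP {classic formula D})[s ->].
elim: s => [|p s [q qP]]; first by exists Top => M b; split.
exists (And p q) => M b /=; rewrite qP; split=> [[pb sb] r|sb].
  by rewrite inE => /orP[/eqP ->|/sb].
by split=> [|r rs]; apply: sb; rewrite inE ?eqxx ?rs ?orbT.
Qed.

(** These equations are what a tuple must satisfy to be named by [l] under some labelling. Positions
    of different sorts are not compared, because each sort has its own labelling. *)
Lemma label_pattern (L : language) (kappa : Type) (D : seq (sorts L))
    (l : labels kappa D) :
  exists q : formula D, forall (M : structure L) (b : prods M D),
    sat q b <-> forall A (v w : var D A),
      plookup v l = plookup w l -> plookup v b = plookup w b.
Proof.
pose P := \bigcup_(x : {A & var D A})
  ((fun w => Eq (Var (projT2 x)) (Var w)) @`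
    [set w | plookup (projT2 x) l = plookup w l]).
have [|q qP] := @finite_conjunction L D P.
  apply: bigcup_finite; first exact: finite_var_sig.
  move=> x _; apply: finite_image; apply: sub_finite_set (finite_var _ _).
  exact: subsetT.
exists q => M b; rewrite qP; split=> [bP A v w vw|bP p [[A v] _ [w vw <-]]].
  by apply: (bP (Eq (Var v) (Var w))); exists (existT _ A v) => //; exists w.
exact: bP.
Qed.

Section Relabelling.
Context (L : language) (T : set (sentence L)) (kappa : Type).

Lemma assignP (mu : lmodel T kappa) D (l : labels kappa D) (b : prods mu D) :
  assign mu l = Some b <->
  forall A (v : var D A), lab mu A (plookup v l) = Some (plookup v b).
Proof.
elim: D l b => [|A D IH] l b; first by case: b; split=> // _ A v; case: (var_nil v).
case: l b => k l [x b]; split=> [|lb] /=.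
  move=> /=; case kx: (lab mu A k) => [y|//]; case ly: (assign mu l) => [c|//].
  move=> [<- <-] B v; elim/var_cons_ind: v => //= C v.
  exact: (IH l c).1.
have /= -> := lb _ (VZ A D); rewrite ((IH l b).2 _) // => B v.
exact: (lb _ (VS A v)).
Qed.

(** Only the labels occurring in [l] are reassigned. They are finitely many, so fibres stay
    infinite, and the hypothesis makes the new values independent of the position chosen. *)
Lemma relabel (mu : lmodel T kappa) D (l : labels kappa D) (b : prods mu D) :
  (forall A (v w : var D A),
    plookup v l = plookup w l -> plookup v b = plookup w b) ->
  exists (lb : forall A, kappa -> option (mu A))
    (lbP : forall A (a : mu A), infinite_set [set k | lb A k = Some a]),
    assign (LModel (@modelP _ _ _ mu) lbP) l = Some b.
Proof.
move=> lb_b.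
pose lb A k := if pselect (exists v : var D A, plookup v l = k) is left e
  then Some (plookup (projT1 (cid e)) b) else lab mu A k.
have lbP A (a : mu A) : infinite_set [set k | lb A k = Some a].
  move=> fin; apply: (@lab_fibre _ _ _ mu A a).
  apply: (@sub_finite_set _ _ ([set k | lb A k = Some a] `|`
      range (fun v : var D A => plookup v l))).
    move=> k ka; have [[v vk]|nv] := pselect (exists v : var D A, plookup v l = k).
      by right; exists v.
    by left; rewrite /= /lb; case: pselect.
  by rewrite finite_setU; split=> //; apply: finite_image; exact: finite_var.
exists lb, lbP; apply/assignP => A v; rewrite /= /lb.
case: pselect => [e|[]]; last by exists v.
by case: cid => w /= wv; rewrite (lb_b _ _ _ wv).
Qed.
End Relabelling.

Section Definable.
Context (L : language) (T : set (sentence L)) (kappa : Type) (G : seq (sorts L)).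
Local Notation sheaf := (dsheaf T kappa G).

Definition definable (p : formula G) : set sheaf :=
  [set e | sat p (dval (e : dpoint T kappa G))].

Lemma definable_eqsubsheaf p : eqsubsheaf (definable p).
Proof.
split.
  have -> : definable p =
      @Vdef L T kappa G [::] (fren p (fun A => @vinl _ G [::] A)) tt.
    apply/seteqP; split=> [e pe|e [[]]].
      by exists tt => //; rewrite (sat_ren p (agree_inl _ _)).
    by rewrite (sat_ren p (agree_inl _ _)).
  exact: openVdef.
move=> [mu nu f] [mu' a] /= he; move: (he) f; case: _ / he => he f.
by rewrite /definable /= /dact (Prop_irrelevance he erefl) /= sat_iso.
Qed.

(* The parameters of a basic open set [psi(x, mu(l))] around [e] can be
   quantified away, keeping only the equalities among them: any witnesses
   satisfying these are named by [l] after a relabelling, and the identity is an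
   isomorphism from the relabelled model. *)
Lemma eqsubsheaf_definable (U : set sheaf) (e : sheaf) :
  eqsubsheaf U -> U e ->
  exists p, definable p e /\ definable p `<=` U.
Proof.
move=> [oU eqU] Ue; have [D [psi [l [[b /= lb pb] sU]]]] := open_dpoint oU Ue.
have [q qP] := label_pattern l.
exists (exs_r (And psi (fren q (fun A => @vinr _ G D A)))); split.
  apply/sat_exs_r; exists b; split => //.
  rewrite (sat_ren q (agree_inr _ _)) qP => A v w vw.
  by have /assignP lbP := lb; apply: Some_inj; rewrite -!lbP vw.
move=> [mu a] /sat_exs_r[c /= [pc]].
rewrite (sat_ren q (agree_inr _ _)) qP => /relabel[lb' [lbP' lc]].
pose nu := LModel (@modelP _ _ _ mu) lbP'.
have Unu : U (@DPoint L T kappa G nu a) by apply: sU; exists c.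
have := eqU (@Arrow L T kappa nu mu (iso_id mu)) (@DPoint L T kappa G nu a)
  erefl Unu.
by rewrite /= dactE pmap_prods_id.
Qed.
End Definable.

(** * Definable families and compact equivariant subsheaves *)

Theorem theorem1p6p4 (L : language) (kappa : Type)
    (kappa_regular : regular_cardinal kappa)
    (kappa_ge : [set: (symbols L + nat)%type] #<= [set: kappa])
    (T : set (sentence L)) (G : seq (sorts L))
    (S : forall mu : lmodel T kappa, set (prods mu G)) :
  (exists phi : formula G,
    forall mu : lmodel T kappa, S mu = [set a | sat phi a]) <->
  compact_eqsubsheaf
    ([set e | S (dbase e) (dval e)] : set (dsheaf T kappa G)).
Proof.
split=> [[phi phiP]|[eqE cE]].
  have -> : ([set e | S (dbase e) (dval e)] : set (dsheaf T kappa G)) =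
      definable phi by apply/seteqP; split=> e; rewrite /= phiP.
  split=> [|C CE cover]; first exact: definable_eqsubsheaf.
  (* A point satisfying [Gam] would lie in [definable phi] but in no member of [C], each member
     being a union of definable sets. Hence some finite part of [Gam] is unsatisfiable, and its
     negations select the finite subcover. *)
  pose Gam : set (formula G) := [set p | p = phi \/
    exists2 q, p = Not q & exists2 U, C U & definable q `<=` U].
  have [nfin|fin] := pselect (exists2 s : seq {classic formula G},
      (forall p, p \in s -> Gam p) &
      forall (mu : lmodel T kappa) (a : prods mu G), ~ forall p, p \in s -> sat p a).
    have [s sG nsat] := nfin.
    (* Each negation in [s] is assigned a member of the cover; [set0] is a default value. *)
    have /choice[F FP] : forall p : {classic formula G},
        exists U : set (dsheaf T kappa G),
        p \in s -> p <> phi -> exists2 q, p = Not q & C U /\ definable q `<=` U.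
      move=> p; have [/sG[->|[q pq [U CU qU]]]|np] := pselect (p \in s).
      - by exists set0.
      - by exists U => _ _; exists q.
      - by exists set0.
    (* Leaving out [phi] is harmless: it holds on all of [definable phi], so the formula of [s]
       failing at a point there is a negation. *)
    exists (F @` [set p | p \in s /\ p <> phi]); split.
    - by move=> _ [p [ps np] <-]; have [q _ []] := FP p ps np.
    - apply: finite_image; apply: sub_finite_set (finite_seq s).
      by move=> p [].
    apply/seteqP; split=> [e [_ [p [ps np] <-]]|[mu a] pe].
      have [q _ [CF _]] := FP p ps np; exact: (CE _ CF).2.
    have /existsNP[p /not_implyP[ps npa]] := nsat mu a.
    have np : p <> phi by move=> pphi; apply: npa; rewrite pphi.
    have [q pq [CF qF]] := FP p ps np.
    exists (F p); first by exists p.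
    by apply: qF; apply: contrapT => nq; apply: npa; rewrite pq.
  (* Otherwise [Gam] is finitely satisfiable, and the point given by compactness contradicts the
     covering. *)
  have [s sG|mu [a aP]] := @compactness L kappa T G Gam kappa_regular kappa_ge.
    apply: contrapT => nsat; apply: fin; exists s => // mu a pa.
    by apply: nsat; exists mu, a.
  have : definable phi (@DPoint L T kappa G mu a) by apply: aP; left.
  rewrite -cover => -[U CU Ua].
  have [q [qa qU]] := eqsubsheaf_definable (CE U CU).1 Ua.
  by have [] : sat (Not q) a by apply: aP; right; exists q => //; exists U.
set E : set (dsheaf T kappa G) := [set e | _] in eqE cE *.
(* Compactness is applied to the cover of [E] by all definable sets inside it. *)
have [||C' [C'C finC' C'E]] := cE [set U | U `<=` E /\ exists p, U = definable p].
- move=> U [UE [p Up]]; split=> //; rewrite Up; exact: definable_eqsubsheaf.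
- apply/seteqP; split=> [e [U [UE _]]|e Ee]; first exact: UE.
  have [p [pe pE]] := eqsubsheaf_definable eqE Ee.
  by exists (definable p) => //; split=> //; exists p.
have /choice[F FP] : forall U : set (dsheaf T kappa G), exists p : formula G,
    C' U -> U = definable p.
  move=> U; have [/C'C[_ [p Up]]|nU] := pselect (C' U); first by exists p.
  by exists Top.
(* The finite disjunction is expressed as the negation of a conjunction of negations. *)
have [|q qP] := @finite_conjunction L G ((fun U => Not (F U)) @` C').
  exact: finite_image.
exists (Not q) => mu; apply/seteqP; split=> a.
  move=> Sa; have : E (@DPoint L T kappa G mu a) by [].
  rewrite -C'E => -[U C'U Ua] /= /qP/(_ (Not (F U)))[]; first by exists U.
  by move: Ua; rewrite {1}(FP U C'U).
move=> /= nq; suff : E (@DPoint L T kappa G mu a) by [].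
rewrite -C'E; apply: contrapT => nU; apply: nq; apply/qP => _ [U C'U <-] /= Fa.
by apply: nU; exists U => //; rewrite (FP U C'U).
Qed.
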